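(* Let $M\ge 1$ be an integer and let $a_1,\dots,a_{M+3},b_1,\dots,b_{M+3}$ be complex parameters satisfying $$a_1a_2\cdots a_{M+3}=q^2\,b_1b_2\cdots b_{M+3}.$$ Then $$\sum_{k=2}^{M+3}\tilde C_k\int_{q/a_1}^{q/a_k}\prod_{i=1}^{M+3}\frac{(a_it)_\infty}{(b_it)_\infty}\,d_qt=0,$$ where, for $2\le k\le M+3$, $$\tilde C_k=\left(\frac{a_k}{a_1}\right)^2\prod_{i=1}^{M+3}\frac{\theta(a_k/b_i)}{\theta(a_1/b_i)}\prod_{\substack{1\le i\le M+3\\ i\ne 1}}\theta(a_1/a_i)\prod_{\substack{1\le i\le M+3\\ i\ne k}}\theta(a_k/a_i)^{-1}.$$
   Context: Fix $q\in\mathbb{C}$ with $0<|q|<1$. Notation: $(a)_\infty=\prod_{i=0}^\infty(1-aq^i)$; $\theta(x)=(x)_\infty(q/x)_\infty$. The Jackson integral is defined by $\int_0^\tau f(t)\,d_qt=(1-q)\sum_{n=0}^\infty f(\tau q^n)\tau q^n$ and $\int_{\tau_1}^{\tau_2}f(t)\,d_qt=\int_0^{\tau_2}f(t)\,d_qt-\int_0^{\tau_1}f(t)\,d_qt$. Parameters are understood to be nonzero and generic in the sense that every expression appearing is well defined, i.e. no denominator vanishes: $a_i/a_j\notin q^{\mathbb{Z}}$ for $i\neq j$, $\theta(a_1/b_i)\ne0$ for all $i$, and $(b_it)_\infty\neq 0$ at all points $t=q^{n+1}/a_k$, $n\ge 0$, occurring in the Jackson integrals. *)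

(* Defs.v *)
From HB Require Import structures.
From mathcomp Require Import all_boot all_order all_algebra.
From mathcomp Require Import all_classical all_reals all_analysis.
From mathcomp Require Import complex.

Set Implicit Arguments.
Unset Strict Implicit.
Unset Printing Implicit Defensive.

Import Order.TTheory GRing.Theory Num.Theory.
Import numFieldNormedType.Exports.

Local Open Scope classical_set_scope.
Local Open Scope ring_scope.

(* Stated over an abstract numFieldType K because numFieldNormedType equips
   every such K with the topology of its norm, whereas R[i] written directly
   does not unify with it; K is meant to be R[i] for R : realType.
   [limn] is total: a divergent sequence gets an unspecified value. *)

(* (a)_oo; the partial products converge for every a as soon as |q| < 1. *)
Definition qpoch (K : numFieldType) (q a : K) : K :=
  limn (fun n : nat => \prod_(0 <= i < n) (1 - a * q ^+ i)).

Definition qtheta (K : numFieldType) (q x : K) : K :=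
  qpoch q x * qpoch q (q / x).

Definition jackson0 (K : numFieldType) (q : K) (f : K -> K) (tau : K) : K :=
  (1 - q) * limn (series (fun n : nat => f (tau * q ^+ n) * (tau * q ^+ n))).

Definition jackson (K : numFieldType) (q : K) (f : K -> K) (tau1 tau2 : K) : K :=
  jackson0 q f tau2 - jackson0 q f tau1.

Definition integrand (K : numFieldType) (q : K) (N : nat) (a b : 'I_N -> K)
    (t : K) : K :=
  \prod_(i < N) (qpoch q (a i * t) / qpoch q (b i * t)).

(* The index ord0 plays the role of 1, and k : 'I_N.+1 that of k + 1. *)
Definition Ctilde (K : numFieldType) (q : K) (N : nat) (a b : 'I_N.+1 -> K)
    (k : 'I_N.+1) : K :=
  (a k / a ord0) ^+ 2
  * (\prod_(i < N.+1) (qtheta q (a k / b i) / qtheta q (a ord0 / b i)))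
  * (\prod_(i < N.+1 | i != ord0) qtheta q (a ord0 / a i))
  * (\prod_(i < N.+1 | i != k) (qtheta q (a k / a i))^-1).

(* Main.v *)
Require Import Defs.
From mathcomp Require Import all_boot all_order all_algebra.
From mathcomp Require Import all_classical all_reals all_analysis.
From mathcomp Require Import complex ring.

(** Let H(u) be the quotient of the products of (q u/b_i)_oo and (q u/a_i)_oo.
    Its poles are u = a_k q^(-n-1), the residues there are, up to a factor
    depending only on k, the terms of the Jackson integral from 0 to q/a_k, and
    because of the balancing condition all residues of H sum to zero.
    Likewise the coefficients C_k sum to zero.

    Both facts are limits of Lagrange interpolation: a polynomial of degree at
    most D - 2 divided by a product of D distinct linear factors has residue
    sum zero.  For the truncation of H to m factors in each numerator and
    m + 1 in each denominator, the residue at a_k q^(-n-1) is, up to such a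
    factor, L_k(m - n) R_k(n) q^n.  Letting m tend to infinity, the convolution
    tends to lim L_k times the sum of q^n R_k(n).  For u H(u) the factor q^n
    disappears, and dividing by m + 1 gives lim L_k times lim R_k, which is the
    theta quotient in C_k. *)

Set Implicit Arguments.
Unset Strict Implicit.
Unset Printing Implicit Defensive.

Import Order.TTheory GRing.Theory Num.Theory.
Import numFieldNormedType.Exports.

Local Open Scope classical_set_scope.
Local Open Scope ring_scope.

(** * Lagrange interpolation and sums of residues *)

(** The sum is the coefficient of degree [#|I| - 1] of the Lagrange interpolant of [P] at the nodes.
    The interpolant is [P] itself, whose size is too small for that coefficient to be nonzero. *)
Lemma lagrange_top_coef (F : fieldType) (I : finType) (x : I -> F)
    (P : {poly F}) :
  injective x -> (size P < #|I|)%N ->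
  \sum_k P.[x k] / (\prod_(j | j != k) (x k - x j)) = 0.
Proof.
move=> xI szP.
have den0 k : \prod_(j | j != k) (x k - x j) != 0.
  by apply/prodf_neq0 => j jk; rewrite subr_eq0 (inj_eq xI) eq_sym.
pose L k := \prod_(j | j != k) ('X - (x j)%:P).
have cardk (k : I) : #|[pred j | j != k]| = #|I|.-1.
  by rewrite -(cardC1 k); apply: eq_card => j; rewrite !inE.
have szL k : size (L k) = #|I|.
  rewrite /L -big_filter size_prod_XsubC.
  rewrite size_filter -sum1_count [X in X.+1](_ : _ = #|I|.-1) ?prednK //.
    exact: leq_ltn_trans szP.
  by rewrite -(cardk k) -sum1_card.
have LM k : L k \is monic by apply: monic_prod_XsubC.
pose Q := \sum_k (P.[x k] / \prod_(j | j != k) (x k - x j)) *: L k.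
have szQ : (size Q <= #|I|)%N.
  apply: leq_trans (size_sum _ _ _) _; apply/bigmax_leqP => k _.
  by rewrite (leq_trans (size_scale_leq _ _)) // szL.
(* Both have size at most [#|I|], and their difference vanishes at the [#|I|] distinct nodes. *)
have QP : Q = P.
  apply/eqP; rewrite -subr_eq0; apply/eqP.
  apply: (@roots_geq_poly_eq0 _ _ [seq x i | i <- enum I]).
  - apply/allP => _ /mapP [i _ ->]; rewrite /root hornerD hornerN subr_eq0.
    rewrite /Q horner_sum (bigD1 i) //= [X in _ + X]big1 ?addr0 => [|k ki].
      rewrite hornerZ /L horner_prod.
      under [X in _ / _ * X]eq_bigr do rewrite hornerXsubC.
      by rewrite divfK.
    rewrite hornerZ /L horner_prod [X in _ * X](bigD1 i) /=;
      last by rewrite eq_sym.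
    by rewrite hornerXsubC subrr mul0r mulr0.
  - by rewrite map_inj_uniq ?enum_uniq.
  - rewrite size_map -cardE (leq_trans (size_polyD _ _)) // geq_max szQ.
    rewrite size_polyN.
    exact: ltnW.
have : Q`_(#|I|.-1) = 0.
  by rewrite QP nth_default // -ltnS prednK //; exact: leq_ltn_trans szP.
rewrite /Q coef_sum => E; rewrite -[RHS]E; apply: eq_bigr => k _.
have := monicP (LM k); rewrite lead_coefE szL coefZ => ->.
by rewrite mulr1.
Qed.

(** Each summand is, up to sign, the residue at [x k] of [P] over the product of the 1 - u / x_j.
    Normalising the factors x_k - x_j by -x_j leaves a k-independent constant and the extra factor
    [x k]. *)
Lemma lagrange_top_coef_quot (F : fieldType) (I : finType) (x : I -> F)
    (P : {poly F}) :
  injective x -> (forall k, x k != 0) -> (size P < #|I|)%N ->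
  \sum_k x k * P.[x k] / (\prod_(j | j != k) (1 - x k / x j)) = 0.
Proof.
move=> xI x0 szP.
pose c := \prod_j (- x j).
have c0 : c != 0 by apply/prodf_neq0 => j _; rewrite oppr_eq0.
transitivity (- c * \sum_k P.[x k] / (\prod_(j | j != k) (x k - x j))).
  2: by rewrite lagrange_top_coef ?mulr0.
rewrite mulr_sumr.
apply: eq_bigr => k _.
have -> : \prod_(j | j != k) (x k - x j) =
    \prod_(j | j != k) (- x j) * \prod_(j | j != k) (1 - x k / x j).
  rewrite -big_split; apply: eq_bigr => j _ /=.
  by rewrite mulrBr mulr1 mulNr mulrC divfK // opprK addrC.
rewrite /c [X in - X * _](bigD1 k) //= invfM.
set d := \prod_(_ | _) (- _); have d0 : d != 0.
  by apply/prodf_neq0 => j _; rewrite oppr_eq0.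
by rewrite -[LHS]mul1r -(mulfV d0); ring.
Qed.

(** * Finite q-products and the residues of the truncated quotient *)

Definition qpochn (F : fieldType) (q : F) (n : nat) (x : F) : F :=
  \prod_(0 <= i < n) (1 - x * q ^+ i).

Section FiniteProducts.
Variables (F : fieldType) (q : F).
Hypothesis q0 : q != 0.

(** After reversal the factors are 1 - x q^(-i) for 1 <= i <= n, and each equals -x q^(-i) (1 - q^i
    / x). *)
Lemma prod_shift_low (n : nat) (x : F) : x != 0 ->
  \prod_(0 <= j < n) (1 - x * q ^+ j / q ^+ n) =
  x ^+ n * \prod_(0 <= j < n) (- (q ^+ j.+1)^-1) * qpochn q n (q / x).
Proof.
move=> x0; rewrite big_nat_rev add0n /=.
have -> : x ^+ n = \prod_(0 <= j < n) x by rewrite prodr_const_nat subn0.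
rewrite -!big_split /=; apply: eq_big_nat => j /andP[_ jn].
have -> : q ^+ n = q ^+ (n - j.+1) * (q * q ^+ j).
  by rewrite -exprS -exprD subnK.
by rewrite exprS; field; rewrite x0 q0 !expf_neq0.
Qed.

Lemma prod_shift_high (n m : nat) (x : F) : (n <= m)%N ->
  \prod_(n <= j < m) (1 - x * q ^+ j / q ^+ n) = qpochn q (m - n) x.
Proof.
move=> nm; rewrite -{1}[n]add0n big_addn; apply: eq_bigr => j _.
by rewrite exprD -!mulrA mulfV ?expf_neq0 // mulr1.
Qed.

Lemma prod_shift (n m : nat) (x : F) : x != 0 -> (n <= m)%N ->
  \prod_(0 <= j < m) (1 - x * q ^+ j / q ^+ n) =
  x ^+ n * \prod_(0 <= j < n) (- (q ^+ j.+1)^-1) * qpochn q n (q / x)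
  * qpochn q (m - n) x.
Proof.
move=> x0 nm; rewrite (@big_cat_nat _ _ _ n) //= prod_shift_low //.
by rewrite prod_shift_high.
Qed.

(** The case x = 1 without its vanishing factor j = n: this is the contribution of the other nodes
    a_k q^(-j) to the residue at a_k q^(-n). The range has m + 1 indices because the denominators
    are truncated one factor later than the numerators. *)
Lemma prod_shift_skip (n m : nat) : (n <= m)%N ->
  \prod_(0 <= j < m.+1 | j != n) (1 - q ^+ j / q ^+ n) =
  \prod_(0 <= j < n) (- (q ^+ j.+1)^-1) * qpochn q n q * qpochn q (m - n) q.
Proof.
move=> nm; rewrite (@big_cat_nat _ _ _ n) //=; last exact: leqW.
congr (_ * _).
  have := @prod_shift_low n 1 (oner_neq0 _).
  rewrite expr1n mul1r divr1 => <-; rewrite big_nat_cond [RHS]big_nat_cond.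
  apply: eq_big => [j|j _]; last by rewrite mul1r.
  by case: ltnP => [/ltn_eqF ->|]; rewrite ?andbT ?andbF.
rewrite big_ltn_cond ?ltnS // eqxx /=.
rewrite -[in RHS]subSS -(@prod_shift_high n.+1 m.+1) ?ltnS //.
rewrite big_nat_cond [RHS]big_nat_cond; apply: eq_big => [j|j].
  by case: ltnP => [/gtn_eqF ->|]; rewrite ?andbT ?andbF.
move=> _; rewrite exprS invfM mulrACA mulfV // mul1r //.
Qed.

End FiniteProducts.

(* The nodes [a k / q ^+ n] are the poles a_k q^(-n-1) with u rescaled by q.  In
   the residue there, [resL k (m - n)] comes from the factors [1 - q ^+ j * c]
   with [j >= n] and [resR k n] from those with [j < n], after extracting powers
   of q that cancel by the balancing condition up to [q ^+ (2 * n)]. *)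
Definition resL (F : fieldType) (q : F) (N : nat) (a b : 'I_N -> F)
    (k : 'I_N) (l : nat) : F :=
  (\prod_i qpochn q l (a k / b i)) /
  ((\prod_(i | i != k) qpochn q l.+1 (a k / a i)) * qpochn q l q).

Definition resR (F : fieldType) (q : F) (N : nat) (a b : 'I_N -> F)
    (k : 'I_N) (n : nat) : F :=
  \prod_i (qpochn q n (q / (a k / b i)) / qpochn q n (q / (a k / a i))).

(** The vanishing residue sum of u^p times the truncated quotient. The case p = 0 leads to the
    Jackson series, p = 1 to the theta quotients. *)
Lemma residue_sum (F : fieldType) (q : F) (N : nat) (a b : 'I_N -> F)
    (p m : nat) :
  q != 0 -> (forall n, q ^+ n.+1 != 1) ->
  (forall i, a i != 0) -> (forall i, b i != 0) ->
  (forall (i j : 'I_N) (s : int), i != j -> a i / a j != q ^ s) ->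
  \prod_i a i = q ^+ 2 * \prod_i b i -> (p.+1 < N)%N ->
  \sum_k \sum_(n < m.+1)
     (a k / q ^+ n) ^+ p.+1 * q ^+ (2 * n)
     * resL q a b k (m - n) * resR q a b k n = 0.
Proof.
move=> q0 q1 a0 b0 aa bal pN.
pose x (kn : 'I_N * 'I_m.+1) := a kn.1 / q ^+ kn.2.
have qn0 n : q ^+ n != 0 by rewrite expf_neq0.
have x0 kn : x kn != 0 by rewrite mulf_neq0 ?invr_neq0.
have qinj (i j : nat) : q ^+ i = q ^+ j -> i = j.
  wlog ij : i j / (i <= j)%N.
    by move=> H E; case/orP: (leq_total i j) => /H ->.
  move=> E; apply/eqP; rewrite eqn_leq ij /= leqNgt; apply/negP => lt.
  have := q1 (j - i.+1)%N; rewrite -subSn // subSS.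
  rewrite -(inj_eq (mulfI (qn0 i))) -exprD subnKC ?(ltnW lt) // mulr1 E.
  by rewrite eqxx.
have xI : injective x.
  move=> [i u] [j v]; rewrite /x /= => E.
  have [ij|ij] := eqVneq i j.
    rewrite -ij in E *; congr (_, _); apply/val_inj/qinj.
    by apply: invr_inj; exact: (mulfI (a0 i)).
  (* Equal nodes with i different from j would make a_i / a_j an integral power of q. *)
  have /eqP[] := aa i j (u%:Z - v%:Z) ij.
  rewrite expfzDr // -invr_expz -!exprnP.
  apply: (mulIf (a0 j)); rewrite divfK //.
  rewrite mulrAC -mulrA -E mulrCA mulfV ?mulr1 //.
(* The exponent is p, not p + 1: [lagrange_top_coef_quot] supplies one more factor [x k]. *)
pose P : {poly F} :=
  'X^p * \prod_i \prod_(0 <= j < m) (1 - (q ^+ j / b i) *: 'X).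
(* The degree is at most p + N m and there are N (m + 1) nodes, so p + 1 < N is exactly what this
   count asks for. *)
have szP : (size P < #|{: 'I_N * 'I_m.+1}|)%N.
  have sz1 (c : F) : (size (1 - c *: 'X)%R <= 2)%N.
    rewrite (leq_trans (size_polyD _ _)) // geq_max size_poly1 size_polyN.
    by rewrite (leq_trans (size_scale_leq _ _)) // size_polyX.
  have szi i : (size (\prod_(0 <= j < m) (1 - (q ^+ j / b i) *: 'X))%R
      <= m.+1)%N.
    elim: m {x x0 xI P} => [|l IH]; first by rewrite big_geq // size_poly1.
    rewrite big_nat_recr //= (leq_trans (size_polyMleq _ _)) //.
    rewrite -ltnS -[(_ + _).-1.+1]/(_.-1.+1).
    have := leq_add IH (sz1 (q ^+ l / b i)); rewrite addn2.
    by case: (_ + _)%N.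
  have szall : (size (\prod_i \prod_(0 <= j < m)
      (1 - (q ^+ j / b i) *: 'X))%R <= (N * m).+1)%N.
    rewrite (leq_trans (size_prod_leq _ _)) // ?cardE size_enum_ord.
    rewrite leq_subLR addnS ltnS -mulnS.
    rewrite (leq_trans (leq_sum _ (fun i _ => szi i))) //.
    by rewrite sum_nat_const card_ord.
  rewrite card_prod !card_ord /P (leq_ltn_trans (size_polyMleq _ _)) //.
  rewrite size_polyXn addSn /= mulnS.
  apply: (@leq_ltn_trans (p + (N * m).+1)); first by rewrite leq_add2l.
  by rewrite addnS -addSn ltn_add2r.
have := lagrange_top_coef_quot xI x0 szP.
rewrite -(pair_big xpredT xpredT (fun k n => x (k, n) * P.[x (k, n)] /
  \prod_(j | j != (k, n)) (1 - x (k, n) / x j))) /= => E.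
rewrite -[RHS]E; apply: eq_bigr => k _; apply: eq_bigr => -[n nm'] _ /=.
have nm : (n <= m)%N by rewrite -ltnS.
rewrite -!mulrA exprS -!mulrA; congr (a k * (_ * _)).
rewrite /P hornerM hornerXn -mulrA; congr (_ ^+ p * _).
(* The signs and powers of q from the low factors; [g] occurs once per index i above and once below,
   and cancels. *)
pose g := \prod_(0 <= j < n) (- (q ^+ j.+1)^-1).
have g0 : g != 0.
  by rewrite prodf_seq_neq0; apply/allP => j _; rewrite oppr_eq0 invr_eq0 qn0.
have -> : (\prod_i \prod_(0 <= j < m) (1 - (q ^+ j / b i) *: 'X)).[a k / q ^+ n]
   = \prod_i ((a k / b i) ^+ n * g * qpochn q n (q / (a k / b i))
              * qpochn q (m - n) (a k / b i)).
  rewrite horner_prod; apply: eq_bigr => i _.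
  rewrite -prod_shift // ?mulf_neq0 ?invr_eq0 // horner_prod.
  apply: eq_bigr => j _; rewrite hornerD hornerN hornerZ hornerX hornerC.
  by congr (1 - _); field; rewrite qn0 b0.
(* For i = k the node itself is skipped, leaving m - n high factors; for every other i there are m -
   n + 1. *)
have -> : \prod_(j | j != (k, Ordinal nm'))
    (1 - x (k, Ordinal nm') / x j)
   = \prod_i ((a k / a i) ^+ n * g * qpochn q n (q / (a k / a i))
      * (if i == k then qpochn q (m - n) q
         else qpochn q (m - n).+1 (a k / a i))).
  transitivity (\prod_i \prod_(j < m.+1 | (i, val j) != (k, n))
       (1 - a k / a i * q ^+ j / q ^+ n)).
    rewrite pair_big_dep /=; apply: eq_big => [[i j]|[i j] _] //=.
    by rewrite /x /=; congr (1 - _); field; rewrite !qn0 a0.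
  apply: eq_bigr => i _; case: eqVneq => [->|ik].
    rewrite mulfV // expr1n mul1r divr1.
    rewrite -prod_shift_skip // big_mkord; apply: eq_big => [j|j _].
      by rewrite xpair_eqE eqxx.
    by rewrite mul1r.
  rewrite -subSn // -prod_shift ?mulf_neq0 ?invr_eq0 // ?leqW // big_mkord.
  by apply: eq_bigl => j; rewrite xpair_eqE (negPf ik).
(* The remaining n-th powers combine to the n-th power of the product of a_i / b_i, which is q^2 by
   balancing. *)
have bal' : q ^+ (2 * n) = \prod_i ((a k / b i) ^+ n / (a k / a i) ^+ n).
  transitivity (\prod_i ((a i) ^+ n / (b i) ^+ n)).
    rewrite big_split /= prodfV !prodrXl bal exprMn -exprM mulfK //.
    by rewrite expf_neq0 //; apply/prodf_neq0.
  apply: eq_bigr => i _; rewrite !expr_div_n.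
  by field; rewrite !expf_neq0.
rewrite bal' /resL /resR mulrC.
have -> : (\prod_(i | i != k) qpochn q (m - n).+1 (a k / a i)) *
    qpochn q (m - n) q = \prod_i (if i == k then qpochn q (m - n) q
         else qpochn q (m - n).+1 (a k / a i)).
  rewrite [RHS](bigD1 k) //= eqxx mulrC; congr (_ * _).
  by apply: eq_bigr => i /negPf ->.
rewrite -!prodfV -!big_split /=; apply: eq_bigr => i _.
rewrite !invfM.
rewrite -/g -[LHS]mul1r -(mulfV g0).
ring.
Qed.

(** * Limits of sums and products, real-valued norms, and the Toeplitz theorem *)

Lemma cvg_sumn (K : numFieldType) (I : Type) (r : seq I) (P : pred I)
    (f : I -> nat -> K) (l : I -> K) :
  (forall i, P i -> f i @ \oo --> l i) ->
  (fun n => \sum_(i <- r | P i) f i n) @ \oo --> \sum_(i <- r | P i) l i.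
Proof.
move=> h; elim: r => [|i r IH].
  by rewrite big_nil; under eq_fun do rewrite big_nil; exact: cvg_cst.
rewrite big_cons; under eq_fun do rewrite big_cons.
by case: ifP => [/h Pi|//]; apply: cvgD.
Qed.

Lemma cvg_prodn (K : numFieldType) (I : Type) (r : seq I) (P : pred I)
    (f : I -> nat -> K) (l : I -> K) :
  (forall i, P i -> f i @ \oo --> l i) ->
  (fun n => \prod_(i <- r | P i) f i n) @ \oo --> \prod_(i <- r | P i) l i.
Proof.
move=> h; elim: r => [|i r IH].
  by rewrite big_nil; under eq_fun do rewrite big_nil; exact: cvg_cst.
rewrite big_cons; under eq_fun do rewrite big_cons.
by case: ifP => [/h Pi|//]; apply: cvgM.
Qed.

(* The norm of a numFieldType takes its values in K itself; here it is read in a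
   realType, and completeness, which numFieldType lacks, is added. *)
Record realNorm (R : realType) (K : numFieldType) := RealNorm {
  nrm :> K -> R;
  nrm_ge0 : forall z, 0 <= nrm z;
  nrm_nat : forall n, nrm n%:R = n%:R;
  nrmN : forall z, nrm (- z) = nrm z;
  nrmV : forall z, nrm z^-1 = (nrm z)^-1;
  nrmM : forall x y, nrm (x * y) = nrm x * nrm y;
  nrmD : forall x y, nrm (x + y) <= nrm x + nrm y;
  nrm_cvgP : forall (u : nat -> K) l,
    u @ \oo --> l <-> (fun n => nrm (u n - l)) @ \oo --> (0 : R);
  nrm_complete : forall (u : nat -> K) (C r : R), 0 <= r -> r < 1 ->
    (forall n, nrm (u n.+1 - u n) <= C * r ^+ n) -> cvgn u
}.

Section RealNorm.
Variables (R : realType) (K : numFieldType) (nu : realNorm R K).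

Lemma nrm0 : nu 0 = 0.
Proof. exact: (nrm_nat nu 0). Qed.

Lemma nrm1 : nu 1 = 1.
Proof. exact: (nrm_nat nu 1). Qed.

Lemma nrmX x n : nu (x ^+ n) = nu x ^+ n.
Proof. by elim: n => [|n IH]; rewrite ?nrm1 // !exprS nrmM IH. Qed.

Lemma nrm_sum (I : Type) (r : seq I) (P : pred I) (f : I -> K) :
  nu (\sum_(i <- r | P i) f i) <= \sum_(i <- r | P i) nu (f i).
Proof.
elim/big_ind2: _ => [|x1 x2 y1 y2 h1 h2|//]; first by rewrite nrm0.
by rewrite (le_trans (nrmD _ _ _)) // lerD.
Qed.

Lemma cvgn_bounded (u : nat -> K) (l : K) :
  u @ \oo --> l -> exists2 B : R, 0 <= B & forall n, nu (u n) <= B.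
Proof.
move=> /(nrm_cvgP nu) /cvgP /cvg_seq_bounded [B [_ /(_ (B + 1))]].
rewrite ltrDl => /(_ ltr01) h; exists (`|B + 1| + nu l).
  by rewrite addr_ge0 ?nrm_ge0.
move=> n; rewrite -[u n](subrK l) (le_trans (nrmD _ _ _)) // lerD2r.
apply: le_trans (ler_norm _) _; apply: le_trans (ler_norm _).
exact: h.
Qed.

Lemma cvgn_toeplitz (w : nat -> nat -> K) (z : nat -> K) (B : R)
    (W l : K) :
  (forall m, \sum_(n < m.+1) nu (w m n) <= B) ->
  (forall n, (fun m => w m n) @ \oo --> (0 : K)) ->
  (fun m => \sum_(n < m.+1) w m n) @ \oo --> W ->
  z @ \oo --> l ->
  (fun m => \sum_(n < m.+1) w m n * z n) @ \oo --> W * l.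
Proof.
move=> wB w0 wW zl.
have -> : (fun m => \sum_(n < m.+1) w m n * z n) =
    (fun m => (\sum_(n < m.+1) w m n) * l
              + \sum_(n < m.+1) w m n * (z n - l)).
  apply/funext => m; rewrite mulr_suml -big_split; apply: eq_bigr => n _ /=.
  by rewrite -mulrDr addrC subrK.
have h1 : (fun m => (\sum_(n < m.+1) w m n) * l) @ \oo --> W * l.
  by apply: cvgM => //; apply: cvg_cst.
suff h2 : (fun m => \sum_(n < m.+1) w m n * (z n - l)) @ \oo --> (0 : K).
  by rewrite -[W * l]addr0; exact: (cvgD h1 h2).
have B0 : 0 <= B.
  by apply: le_trans (wB 0%N); apply: sumr_ge0 => i _; exact: nrm_ge0.
apply/(nrm_cvgP nu); under eq_fun do rewrite subr0.
apply/cvgrPdist_lt => e e0.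
have /(nrm_cvgP nu) /cvgrPdist_lt zl' := zl.
(* The divisor is B + 1 because B may be zero. *)
have eB : 0 < e / 2 / (B + 1) by rewrite !divr_gt0 // ltr_wpDl.
have [N _ hN] := zl' _ eB.
have zN n : (N <= n)%N -> nu (z n - l) <= e / 2 / (B + 1).
  by move=> /hN /=; rewrite sub0r normrN ger0_norm ?nrm_ge0 // => /ltW.
have h0 : (fun m => \sum_(n < N) nu (w m n) * nu (z n - l)) @ \oo --> (0 : R).
  have := @cvg_sumn R 'I_N (index_enum _) xpredT
    (fun n m => nu (w m n) * nu (z n - l)) (fun=> 0).
  rewrite big1 //; apply => i _.
  rewrite -[0](mul0r (nu (z i - l))); apply: cvgM; last exact: cvg_cst.
  by have /(nrm_cvgP nu) := w0 i; under eq_fun do rewrite subr0.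
have /cvgrPdist_lt /(_ (e / 2)) h0' := h0.
have e2 : 0 < e / 2 by rewrite divr_gt0.
have {h0'} h0' := h0' e2.
near=> m.
have Nm : (N <= m.+1)%N by apply/leqW; near: m; exact: nbhs_infty_ge.
rewrite sub0r normrN ger0_norm ?nrm_ge0 //.
apply: le_lt_trans (nrm_sum _ _ _) _.
under eq_bigr do rewrite nrmM.
rewrite -(big_mkord xpredT (fun n => nu (w m n) * nu (z n - l))).
rewrite (@big_cat_nat _ _ _ N) //= [e]splitr.
apply: ltr_leD.
  rewrite big_mkord.
  have : `|0 - \sum_(n < N) nu (w m n) * nu (z n - l)| < e / 2.
    by near: m.
  by rewrite sub0r normrN; apply: le_lt_trans; exact: ler_norm.
apply: (@le_trans _ _ (\sum_(N <= n < m.+1) nu (w m n) * (e / 2 / (B + 1)))).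
  rewrite !big_nat; apply: ler_sum => i /andP[Ni _].
  by rewrite ler_wpM2l ?nrm_ge0 // zN.
rewrite -mulr_suml.
apply: (@le_trans _ _ (B * (e / 2 / (B + 1)))).
  apply: ler_wpM2r; first exact: ltW.
  apply: le_trans (wB m).
  rewrite -(big_mkord xpredT (fun n => nu (w m n))).
  rewrite [leRHS](@big_cat_nat _ _ _ N) //=.
  by rewrite lerDr; apply: sumr_ge0 => i _; exact: nrm_ge0.
rewrite mulrCA ger_pMr // ler_pdivrMr ?mul1r ?lerDl // ltr_wpDl //.
Unshelve. all: by end_near. Qed.


End RealNorm.

(** * Geometric bounds, convolutions and means *)

Lemma geometric_sum_le (R : realType) (r : R) n :
  0 <= r -> r < 1 -> \sum_(j < n) r ^+ j <= (1 - r)^-1.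
Proof.
move=> r0 r1; have r1' : 0 < 1 - r by rewrite subr_gt0.
rewrite -(ler_pM2l r1') mulfV ?gt_eqF // -opprB mulNr -subrX1 opprB.
by rewrite lerBlDr lerDl exprn_ge0.
Qed.

Section RealNormSequences.
Variables (R : realType) (K : numFieldType) (nu : realNorm R K).

Lemma sum_rev_ord (V : nmodType) (f : nat -> nat -> V) m :
  \sum_(n < m.+1) f n (m - n)%N = \sum_(n < m.+1) f (m - n)%N n.
Proof.
rewrite (reindex_inj rev_ord_inj) /=; apply: eq_bigr => i _.
by rewrite subSS subKn // -ltnS.
Qed.

Lemma cvgn_subn (u : nat -> K) (l : K) n :
  u @ \oo --> l -> (fun m => u (m - n)%N) @ \oo --> l.
Proof.
move=> ul; rewrite -(cvg_shiftn n).
by under eq_fun do rewrite /= addnK.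
Qed.

Lemma geometric_cvg0 (A : nat -> K) (C r : R) : 0 <= r -> r < 1 ->
  (forall n, nu (A n) <= C * r ^+ n) -> A @ \oo --> (0 : K).
Proof.
move=> r0 r1 h; apply/(nrm_cvgP nu).
apply: (@squeeze_cvgr _ _ _ _ (fun=> 0) (fun n => C * r ^+ n)).
- by apply: nearW => n; rewrite subr0 nrm_ge0 h.
- exact: cvg_cst.
- rewrite -[X in _ --> X](mulr0 C); apply: cvgM; first exact: cvg_cst.
  by apply: cvg_expr; rewrite ger0_norm.
Qed.

Lemma geometric_series_cvg (A : nat -> K) (C r : R) : 0 <= r -> r < 1 ->
  (forall n, nu (A n) <= C * r ^+ n) -> cvgn (series A).
Proof.
move=> r0 r1 h; apply: (nrm_complete r0 r1) => n.
have -> : series A n.+1 - series A n = A n by rewrite seriesSB.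
exact: h.
Qed.

(** The Toeplitz theorem with weights [A (m - n)]: the row sums are partial sums of the series, and
    the geometric bound controls the absolute row sums and the columns. *)
Lemma cvgn_convolution (A X : nat -> K) (C r : R) (S c : K) :
  0 <= r -> r < 1 -> (forall n, nu (A n) <= C * r ^+ n) ->
  series A @ \oo --> S -> X @ \oo --> c ->
  (fun m => \sum_(n < m.+1) A n * X (m - n)%N) @ \oo --> S * c.
Proof.
move=> r0 r1 h AS Xc.
have C0 : 0 <= C.
  by have := h 0%N; rewrite expr0 mulr1; apply: le_trans; exact: nrm_ge0.
under eq_fun do rewrite (sum_rev_ord (fun i j => A i * X j)).
apply: (@cvgn_toeplitz R K nu (fun m n => A (m - n)%N) X (C / (1 - r))) => //.
- move=> m; rewrite -(sum_rev_ord (fun i j => nu (A i))).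
  apply: (@le_trans _ _ (\sum_(n < m.+1) C * r ^+ n)).
    by apply: ler_sum => i _; exact: h.
  by rewrite -mulr_sumr ler_wpM2l // geometric_sum_le.
- by move=> n; apply: cvgn_subn; exact: geometric_cvg0 h.
- under eq_fun do rewrite -(sum_rev_ord (fun i j => A i)).
  move: AS; rewrite -cvg_shiftS.
  by under eq_fun do rewrite seriesEord /=.
Qed.

Lemma cvgn_invS : (fun m => m.+1%:R^-1) @ \oo --> (0 : K).
Proof.
apply/(nrm_cvgP nu); under eq_fun do rewrite subr0 nrmV nrm_nat.
exact: cvg_harmonic.
Qed.

(** Cesaro means: the Toeplitz theorem with constant rows 1 / (m + 1). *)
Lemma cvgn_mean (Y : nat -> K) (d : K) : Y @ \oo --> d ->
  (fun m => \sum_(n < m.+1) m.+1%:R^-1 * Y n) @ \oo --> d.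
Proof.
move=> Yd; rewrite -[d]mul1r.
apply: (@cvgn_toeplitz R K nu (fun m n => m.+1%:R^-1) Y 1) => //.
- move=> m; rewrite sumr_const card_ord nrmV nrm_nat -[_ *+ _]mulr_natl.
  by rewrite mulfV // pnatr_eq0.
- by move=> _; exact: cvgn_invS.
- rewrite [X in X @ _ --> _](_ : _ = fun=> 1); first exact: cvg_cst.
  apply/funext => m; rewrite sumr_const card_ord -(mulr_natr _^-1).
  by rewrite mulVf // pnatr_eq0.
Qed.

(** The Toeplitz theorem with weights X_(m-n) / (m + 1), whose row sums are the Cesaro means of
    X. *)
Lemma cvgn_mean_convolution (X Y : nat -> K) (c d : K) :
  X @ \oo --> c -> Y @ \oo --> d ->
  (fun m => m.+1%:R^-1 * \sum_(n < m.+1) X (m - n)%N * Y n) @ \oo --> c * d.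
Proof.
move=> Xc Yd.
have [B B0 XB] := cvgn_bounded nu Xc.
under eq_fun do rewrite mulr_sumr.
under eq_fun do under eq_bigr do rewrite mulrA.
apply: (@cvgn_toeplitz R K nu (fun m n => m.+1%:R^-1 * X (m - n)%N) Y B) => //.
- move=> m; apply: (@le_trans _ _ (\sum_(n < m.+1) m.+1%:R^-1 * B)).
    by apply: ler_sum => i _; rewrite nrmM nrmV nrm_nat
      ler_wpM2l ?XB // invr_ge0.
  by rewrite sumr_const card_ord -[_ *+ _]mulr_natl mulrA mulfV ?mul1r.
- move=> n; rewrite -[0](mul0r c); apply: cvgM; first exact: cvgn_invS.
  exact: cvgn_subn.
- under eq_fun do rewrite -(sum_rev_ord (fun i j => _ * X i)).
  exact: cvgn_mean.
Qed.

(** From 1 + t <= exp t, the norms of [u] are bounded by that of [u 0] times exp (C / (1 - r));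
    hence the differences u_n e_n decay geometrically. The recursive form serves both the q-products
    and their reciprocals. *)
Lemma cvgn_geometric_prod (u e : nat -> K) (C r : R) : 0 <= r -> r < 1 ->
  (forall n, u n.+1 = u n * (1 + e n)) -> (forall n, nu (e n) <= C * r ^+ n) ->
  cvgn u.
Proof.
move=> r0 r1 uS h.
have C0 : 0 <= C.
  by have := h 0%N; rewrite expr0 mulr1; apply: le_trans; exact: nrm_ge0.
have bound n : nu (u n) <= nu (u 0%N) * expR (C * \sum_(j < n) r ^+ j).
  elim: n => [|n IH]; first by rewrite big_ord0 mulr0 expR0 mulr1.
  rewrite uS nrmM big_ord_recr /= mulrDr expRD mulrA.
  apply: ler_pM; rewrite ?nrm_ge0 //.
  apply: le_trans (nrmD _ _ _) _; rewrite nrm1.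
  by apply: le_trans (expR_ge1Dx _); rewrite lerD2l.
apply: (@nrm_complete _ _ nu u (nu (u 0%N) * expR (C / (1 - r)) * C) r) => // n.
rewrite uS mulrDr mulr1 addrC addKr nrmM -mulrA.
apply: ler_pM; rewrite ?nrm_ge0 //.
apply: le_trans (bound n) _; apply: ler_wpM2l; first exact: nrm_ge0.
by rewrite ler_expR ler_wpM2l // geometric_sum_le.
Qed.

(** * The infinite q-Pochhammer symbol *)

Section QPochhammer.
Variable q : K.
Hypothesis q1 : nu q < 1.

Lemma cvgn_expr0 : (fun n => q ^+ n) @ \oo --> (0 : K).
Proof.
apply: (@geometric_cvg0 _ 1 (nu q)) => //; first exact: nrm_ge0.
by move=> n; rewrite nrmX mul1r.
Qed.

Lemma qpochnS n x : qpochn q n.+1 x = qpochn q n x * (1 - x * q ^+ n).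
Proof. by rewrite /qpochn big_nat_recr. Qed.

Lemma qpochn_cvg x : (fun n => qpochn q n x) @ \oo --> qpoch q x.
Proof.
(* [qpoch] is by definition the [limn] of this sequence, so its convergence is enough. *)
suff : cvgn (fun n => qpochn q n x) by [].
apply: (@cvgn_geometric_prod _ (fun n => - (x * q ^+ n)) (nu x) (nu q)) => //.
- exact: nrm_ge0.
- by move=> n; rewrite qpochnS.
- by move=> n; rewrite nrmN nrmM nrmX.
Qed.

(** The reciprocals of the partial products converge as well, since 1 / (1 - x q^n) = 1 + x q^n / (1
    - x q^n) and the last denominators have bounded inverses. The two limits have product 1, so
    neither is zero. *)
Lemma qpoch_neq0 x : (forall n, x * q ^+ n != 1) -> qpoch q x != 0.
Proof.
move=> xq.
have xq' n : 1 - x * q ^+ n != 0 by rewrite subr_eq0 eq_sym.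
have invc : (fun n => (1 - x * q ^+ n)^-1) @ \oo --> (1 : K).
  rewrite -[X in _ --> X]invr1; apply: cvgV; first exact: oner_neq0.
  rewrite -[X in _ --> X]subr0; apply: cvgB; first exact: cvg_cst.
  rewrite -[X in _ --> X](mulr0 x); apply: cvgM; first exact: cvg_cst.
  exact: cvgn_expr0.
have [B B0 hB] := cvgn_bounded nu invc.
have : cvgn (fun n => (qpochn q n x)^-1).
  apply: (@cvgn_geometric_prod _ (fun n => x * q ^+ n / (1 - x * q ^+ n))
    (nu x * B) (nu q)) => //.
  - exact: nrm_ge0.
  - move=> n; rewrite qpochnS invfM; congr (_ * _).
    by field; rewrite xq'.
  - move=> n; rewrite !nrmM nrmX mulrAC; apply: ler_wpM2r.
      by rewrite exprn_ge0 ?nrm_ge0.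
    by rewrite ler_wpM2l ?nrm_ge0.
move=> vc; have := cvgM vc (@qpochn_cvg x) => h.
have qn0 n : qpochn q n x != 0.
  by rewrite /qpochn prodf_seq_neq0; apply/allP => i _ /=; exact: xq'.
have E : (fun n => (qpochn q n x)^-1 * qpochn q n x) = fun=> 1.
  by apply/funext => n; rewrite mulVf.
apply/eqP => q0; move: h; rewrite q0 mulr0.
rewrite [X in X @ _ --> _]E => h.
have h1 : (fun=> 1 : K) @ \oo --> (1 : K) by exact: cvg_cst.
have E01 : 0 = 1 :> K := cvg_unique (@norm_hausdorff _ K) (h _) h1.
by move/eqP: (oner_neq0 K); rewrite -E01.
Qed.

Lemma qpoch_tail n x : qpoch q x = qpochn q n x * qpoch q (x * q ^+ n).
Proof.
have h1 : (fun m => qpochn q (m + n) x) @ \oo --> qpoch q x.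
  by rewrite (cvg_shiftn n (fun m => qpochn q m x)); exact: qpochn_cvg.
have h2 : (fun m => qpochn q n x * qpochn q m (x * q ^+ n)) @ \oo -->
    qpochn q n x * qpoch q (x * q ^+ n).
  by apply: cvgM; [exact: cvg_cst|exact: qpochn_cvg].
have E : (fun m => qpochn q (m + n) x) =
  (fun m => qpochn q n x * qpochn q m (x * q ^+ n)); last first.
  by rewrite -E in h2; exact: (cvg_unique (@norm_hausdorff _ K) h1 h2).
apply/funext => m; rewrite /qpochn (@big_cat_nat _ _ _ n) ?leq_addl //=.
congr (_ * _); rewrite -{1}[n]add0n big_addn addnK; apply: eq_bigr => i _.
by rewrite exprD -mulrA [q ^+ n * _]mulrC.
Qed.

End QPochhammer.
End RealNormSequences.

(** * Passage to the limit in the residue sums, and the Jackson integrals *)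

Section JacksonIdentity.
Variables (R : realType) (K : numFieldType) (nu : realNorm R K) (q : K).
Variables (N : nat) (a b : 'I_N -> K).
Hypotheses (q0 : q != 0) (q1 : nu q < 1).
Hypotheses (a0 : forall i, a i != 0) (b0 : forall i, b i != 0).
Hypothesis aa : forall (i j : 'I_N) (s : int), i != j -> a i / a j != q ^ s.
Hypothesis bq0 : forall i k, qpoch q (q / (a k / b i)) != 0.
Hypothesis bal : \prod_i a i = q ^+ 2 * \prod_i b i.
Hypothesis N2 : (2 < N)%N.

Definition resL_lim k : K :=
  (\prod_i qpoch q (a k / b i)) /
  ((\prod_(i | i != k) qpoch q (a k / a i)) * qpoch q q).

Definition resR_lim k : K :=
  \prod_i (qpoch q (q / (a k / b i)) / qpoch q (q / (a k / a i))).

Lemma q_expS_neq1 n : q ^+ n.+1 != 1.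
Proof.
apply/eqP => E; have := congr1 nu E; rewrite nrmX nrm1 => /eqP.
by rewrite lt_eqF // exprn_ilt1 ?nrm_ge0.
Qed.

Lemma qpoch_q_neq0 : qpoch q q != 0.
Proof. by apply: (qpoch_neq0 q1) => n; rewrite -exprS q_expS_neq1. Qed.

Lemma qpoch_ratio_neq0 i k : i != k -> qpoch q (a k / a i) != 0.
Proof.
move=> ik; apply: (qpoch_neq0 q1) => n; apply/eqP => E.
have /eqP[] := aa n%:Z ik; rewrite -exprnP.
apply: (mulfI (_ : a k / a i != 0)); first by rewrite mulf_neq0 ?invr_neq0.
by rewrite E; field; rewrite !a0.
Qed.

Lemma qpoch_inv_ratio_neq0 i k : qpoch q (q / (a k / a i)) != 0.
Proof.
apply: (qpoch_neq0 q1) => n; have [->|ik] := eqVneq i k.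
  by rewrite mulfV // divr1 -exprS q_expS_neq1.
apply/eqP => E; rewrite eq_sym in ik; have /eqP[] := aa n.+1%:Z ik.
rewrite -exprnP exprS; apply/esym; rewrite -[RHS]mul1r -E.
by field; rewrite !a0.
Qed.

Lemma resL_cvg k : resL q a b k @ \oo --> resL_lim k.
Proof.
apply: cvgM; first by apply: cvg_prodn => i _; exact: (qpochn_cvg q1).
apply: cvgV.
  rewrite mulf_neq0 ?qpoch_q_neq0 //; apply/prodf_neq0 => i ik.
  exact: qpoch_ratio_neq0.
apply: cvgM; last exact: (qpochn_cvg q1).
apply: cvg_prodn => i _.
rewrite (cvg_shiftS (fun l => qpochn q l (a k / a i))).
exact: (qpochn_cvg q1).
Qed.

Lemma resR_cvg k : resR q a b k @ \oo --> resR_lim k.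
Proof.
apply: cvg_prodn => i _; apply: cvgM; first exact: (qpochn_cvg q1).
apply: cvgV; last exact: (qpochn_cvg q1).
exact: qpoch_inv_ratio_neq0.
Qed.

Lemma resR_lim_neq0 k : resR_lim k != 0.
Proof.
apply/prodf_neq0 => i _.
by apply: mulf_neq0 (bq0 i k) _; rewrite invr_eq0; exact: qpoch_inv_ratio_neq0.
Qed.

(** The case p = 1 of [residue_sum]: (a_k / q^n)^2 cancels q^(2n), so no decaying weight is left and
    the convolution is averaged over m + 1 terms. *)
Lemma theta_quotient_sum : \sum_k a k ^+ 2 * (resL_lim k * resR_lim k) = 0.
Proof.
have h : (fun m => \sum_k a k ^+ 2 * (m.+1%:R^-1 *
    \sum_(n < m.+1) resL q a b k (m - n) * resR q a b k n)) @ \oo -->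
    \sum_k a k ^+ 2 * (resL_lim k * resR_lim k).
  apply: cvg_sumn => k _; apply: cvgM; first exact: cvg_cst.
  by apply: (cvgn_mean_convolution nu); [exact: resL_cvg|exact: resR_cvg].
have E : (fun m => \sum_k a k ^+ 2 * (m.+1%:R^-1 *
    \sum_(n < m.+1) resL q a b k (m - n) * resR q a b k n)) = fun=> 0.
  apply/funext => m.
  have := residue_sum m q0 q_expS_neq1 a0 b0 aa bal N2.
  move=> /(congr1 (fun x => m.+1%:R^-1 * x)); rewrite mulr0 => E.
  rewrite -[RHS]E.
  rewrite mulr_sumr; apply: eq_bigr => k _.
  rewrite mulrCA; congr (_ * _); rewrite mulr_sumr; apply: eq_bigr => n _.
  rewrite mulrA; congr (_ * _); rewrite mulnC exprM.
  by congr (_ * _); rewrite -exprMn divfK ?expf_neq0.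
rewrite E in h; have h0 : (fun=> 0 : K) @ \oo --> (0 : K) by exact: cvg_cst.
exact: (cvg_unique (@norm_hausdorff _ K) h h0).
Qed.

(** By [jackson0E], a multiple of the Jackson integral from 0 to q / a_k. *)
Definition resR_sum k : K := limn (series (fun n => q ^+ n * resR q a b k n)).

Lemma geometric_resR k :
  exists C, forall n, nu (q ^+ n * resR q a b k n) <= C * nu q ^+ n.
Proof.
have [B _ hB] := cvgn_bounded nu (@resR_cvg k).
exists B => n; rewrite nrmM nrmX mulrC.
by rewrite ler_wpM2r // exprn_ge0 ?nrm_ge0.
Qed.

Lemma resR_series_cvg k :
  series (fun n => q ^+ n * resR q a b k n) @ \oo --> resR_sum k.
Proof.
have [C hC] := geometric_resR k.
suff : cvgn (series (fun n => q ^+ n * resR q a b k n)) by [].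
exact: (geometric_series_cvg (nrm_ge0 nu q) q1 hC).
Qed.

(** The case p = 0 of [residue_sum]: a_k q^(-n) times q^(2n) leaves the summable weight q^n. *)
Lemma resR_sum_weighted : \sum_k a k * (resR_sum k * resL_lim k) = 0.
Proof.
have h : (fun m => \sum_k a k * \sum_(n < m.+1)
    (q ^+ n * resR q a b k n) * resL q a b k (m - n)) @ \oo -->
    \sum_k a k * (resR_sum k * resL_lim k).
  apply: cvg_sumn => k _; apply: cvgM; first exact: cvg_cst.
  have [C hC] := geometric_resR k.
  apply: (cvgn_convolution (nrm_ge0 nu q) q1 hC).
    exact: resR_series_cvg.
  exact: resL_cvg.
have E : (fun m => \sum_k a k * \sum_(n < m.+1)
    (q ^+ n * resR q a b k n) * resL q a b k (m - n)) = fun=> 0.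
  apply/funext => m.
  have := residue_sum m q0 q_expS_neq1 a0 b0 aa bal (ltnW N2).
  move=> E; rewrite -[RHS]E; apply: eq_bigr => k _.
  rewrite mulr_sumr; apply: eq_bigr => n _.
  rewrite expr1 mul2n -addnn exprD [a k / q ^+ n * _]mulrA divfK ?expf_neq0 //.
  by ring.
rewrite E in h; have h0 : (fun=> 0 : K) @ \oo --> (0 : K) by exact: cvg_cst.
exact: (cvg_unique (@norm_hausdorff _ K) h h0).
Qed.

(** With y = q a_i / a_k or y = q b_i / a_k, the value (y q^n)_oo is (y)_oo / (y)_n; the finite
    parts form [resR], the infinite ones [resR_lim]. *)
Lemma integrandE k n : integrand q a b (q / a k * q ^+ n) =
  resR q a b k n / resR_lim k.
Proof.
rewrite /integrand /resR /resR_lim -prodfV -big_split; apply: eq_bigr => i _ /=.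
have ea : a i * (q / a k * q ^+ n) = q / (a k / a i) * q ^+ n.
  by field; rewrite !a0.
have eb : b i * (q / a k * q ^+ n) = q / (a k / b i) * q ^+ n.
  by field; rewrite a0 b0.
have := qpoch_inv_ratio_neq0 i k; have := bq0 i k.
(* A nonzero (y)_oo forces both of its factors (y)_n and (y q^n)_oo to be nonzero. *)
rewrite ea eb !(qpoch_tail q1 n (q / _)) !mulf_eq0 !negb_or.
by move=> /andP[u1 u2] /andP[u3 u4]; field; rewrite u1 u2 u3 u4.
Qed.

Lemma jackson0E k : jackson0 q (integrand q a b) (q / a k) =
  (1 - q) * (q / a k / resR_lim k * resR_sum k).
Proof.
rewrite /jackson0; congr (_ * _); apply/cvg_lim; first exact: norm_hausdorff.
have -> : series (fun n =>
    integrand q a b (q / a k * q ^+ n) * (q / a k * q ^+ n))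
    = (fun n => q / a k / resR_lim k *
         series (fun n => q ^+ n * resR q a b k n) n).
  apply/funext => n; rewrite /series /= mulr_sumr; apply: eq_bigr => i _.
  by rewrite integrandE; ring.
by apply: cvgM; [exact: cvg_cst|exact: resR_series_cvg].
Qed.

(** In theta(x) = (x)_oo (q/x)_oo the first factors go to [resL_lim] and the second ones to
    [resR_lim]. Each of these also has one (q)_oo in its denominator, in [resR_lim] from i = k; the
    square compensates. *)
Lemma theta_quotientE k :
  (\prod_i qtheta q (a k / b i)) *
  (\prod_(i | i != k) (qtheta q (a k / a i))^-1) =
  qpoch q q ^+ 2 * (resL_lim k * resR_lim k).
Proof.
rewrite /qtheta /resL_lim /resR_lim prodfV !big_split /= prodfV.
rewrite [\prod_i qpoch q (q / (a k / a i))](bigD1 k) //= mulfV // divr1.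
rewrite !invfM.
have := qpoch_q_neq0; set Q := qpoch q q => Q0.
by rewrite -[LHS]mul1r -(expr1n _ 2) -(mulfV Q0); ring.
Qed.

End JacksonIdentity.

(** Since the C_k sum to zero, the common lower limit q / a_1 drops out. In C_k times the integral
    from 0 to q / a_k, [resR_lim] cancels, which leaves the sum of [resR_sum_weighted]. *)
Theorem jackson_integral_sum (R : realType) (K : numFieldType)
    (nu : realNorm R K) (q : K) (N : nat) (a b : 'I_N.+3 -> K) :
  q != 0 -> nu q < 1 ->
  (forall i, a i != 0) -> (forall i, b i != 0) ->
  (forall (i j : 'I_N.+3) (s : int), i != j -> a i / a j != q ^ s) ->
  (forall i k, qpoch q (q / (a k / b i)) != 0) ->
  \prod_i a i = q ^+ 2 * \prod_i b i ->
  \sum_(k < N.+3 | k != ord0)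
    Ctilde q a b k * jackson q (integrand q a b) (q / a ord0) (q / a k) = 0.
Proof.
move=> q0 q1 a0 b0 aa bq0 bal.
(* The k-independent part of [Ctilde], together with the (q)_oo^2 of [theta_quotientE]. *)
pose kappa := (a ord0)^-1 ^+ 2 * (\prod_i (qtheta q (a ord0 / b i))^-1) *
  (\prod_(i < N.+3 | i != ord0) qtheta q (a ord0 / a i)) * qpoch q q ^+ 2.
have CE k : Ctilde q a b k =
    kappa * (a k ^+ 2 * (resL_lim q a b k * resR_lim q a b k)).
  have E := theta_quotientE b q1 a0 k.
  rewrite /Ctilde big_split /= exprMn /kappa.
  transitivity ((a ord0)^-1 ^+ 2 * (\prod_i (qtheta q (a ord0 / b i))^-1) *
  (\prod_(i < N.+3 | i != ord0) qtheta q (a ord0 / a i)) * a k ^+ 2 *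
  ((\prod_i qtheta q (a k / b i)) *
  (\prod_(i | i != k) (qtheta q (a k / a i))^-1))).
    by ring.
  by rewrite E; ring.
(* The index [ord0] may be added to the sum: its integral runs from q / a_1 to itself. *)
transitivity (\sum_k Ctilde q a b k * jackson0 q (integrand q a b) (q / a k) -
  \sum_k Ctilde q a b k * jackson0 q (integrand q a b) (q / a ord0)).
  rewrite -sumrB [RHS](bigD1 ord0) //= subrr add0r; apply: eq_bigr => k _.
  by rewrite /jackson mulrBr.
rewrite -mulr_suml.
under [X in _ - X * _]eq_bigr do rewrite CE.
rewrite -mulr_sumr (theta_quotient_sum q0 q1) // mulr0 mul0r subr0.
transitivity (kappa * ((1 - q) * q *
   \sum_k a k * (resR_sum q a b k * resL_lim q a b k))).
  rewrite !mulr_sumr; apply: eq_bigr => k _.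
  rewrite CE (jackson0E q1) //.
  by field; rewrite a0 (resR_lim_neq0 q1).
by rewrite (resR_sum_weighted q0 q1) // !mulr0.
Qed.

(* [R[i]] as a numFieldType, so that the topology of its norm is found. *)
Definition Cx (R : realType) : numFieldType := R[i].

(** * The complex modulus as a real-valued norm *)

Section ComplexNorm.
Variable R : realType.
Implicit Types (x y z : Cx R).

(** The norm on [R[i]] is a complex number with zero imaginary part, so the real part retains all of
    it. *)
Definition cnrm z : R := complex.Re (`|z| : R[i]).

Lemma cnrmE z : ((cnrm z)%:C)%C = `|z| :> R[i].
Proof. exact/RRe_real/ger0_real/(normr_ge0 (z : R[i])). Qed.

Lemma realc_inj : injective (fun r : R => (r%:C)%C).
Proof. by move=> r s []. Qed.

Lemma cnrm_ge0 z : 0 <= cnrm z.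
Proof. by rewrite -lecR cnrmE; exact: (normr_ge0 (z : R[i])). Qed.

Lemma cnrmM x y : cnrm (x * y) = cnrm x * cnrm y.
Proof. by apply: realc_inj; rewrite rmorphM /= !cnrmE normrM. Qed.

Lemma cnrmN x : cnrm (- x) = cnrm x.
Proof. by apply: realc_inj; rewrite !cnrmE normrN. Qed.

Lemma cnrmV x : cnrm x^-1 = (cnrm x)^-1.
Proof. by apply: realc_inj; rewrite fmorphV /= !cnrmE normfV. Qed.

Lemma cnrm_nat n : cnrm n%:R = n%:R.
Proof. by apply: realc_inj; rewrite cnrmE normr_nat rmorph_nat. Qed.

Lemma cnrmD x y : cnrm (x + y) <= cnrm x + cnrm y.
Proof. by rewrite -lecR rmorphD /= !cnrmE; exact: (ler_normD (x : R[i])). Qed.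

(** A positive element of [R[i]] is real, so the radii used by the two topologies correspond. *)
Lemma cvg_cnrmP (u : nat -> Cx R) (l : Cx R) :
  u @ \oo --> l <-> (fun n => cnrm (u n - l)) @ \oo --> (0 : R).
Proof.
split=> [/cvgrPdist_lt h|/cvgrPdist_lt h].
- apply/cvgrPdist_lt => e e0.
  have e0' : (0 : Cx R) < ((e%:C)%C : R[i]) by rewrite (ltcR 0).
  near=> n.
  rewrite sub0r normrN ger0_norm ?cnrm_ge0 // -ltcR cnrmE -normrN opprB.
  near: n; exact: h.
- apply/cvgrPdist_lt => e e0.
  have er : ((complex.Re (e : R[i]))%:C)%C = e by apply/RRe_real/gtr0_real.
  have e0' : 0 < complex.Re (e : R[i]) by rewrite -ltcR er.
  near=> n.
  rewrite -normrN opprB -er.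
  suff : cnrm (u n - l) < complex.Re (e : R[i]) by rewrite -ltcR cnrmE.
  have : `|0 - cnrm (u n - l)| < complex.Re (e : R[i]) by near: n; exact: h.
  by rewrite sub0r normrN ger0_norm ?cnrm_ge0.
Unshelve. all: by end_near. Qed.

Lemma ler_Re_cnrm z : `|complex.Re (z : R[i])| <= cnrm z.
Proof. by rewrite -lecR cnrmE; exact: normc_ge_Re. Qed.

(** Im z is the real part of -i z, and i has modulus 1. *)
Lemma ler_Im_cnrm z : `|complex.Im (z : R[i])| <= cnrm z.
Proof.
have := ler_Re_cnrm (- ('i%C : R[i]) * (z : R[i]) : R[i]).
rewrite cnrmM cnrmN.
have -> : cnrm ('i%C : R[i]) = 1.
  by apply: realc_inj; rewrite cnrmE normc_def /= expr0n expr1n add0r sqrtr1.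
rewrite mul1r; apply: le_trans; case: z => x y /=.
by rewrite le_eqVlt; apply/orP; left; apply/eqP; congr `|_|; ring.
Qed.

Lemma cnrm_le_ReIm z :
  cnrm z <= `|complex.Re (z : R[i])| + `|complex.Im (z : R[i])|.
Proof.
have e : z = ((complex.Re (z : R[i]))%:C + 'i * (complex.Im (z : R[i]))%:C)%C.
  exact: complexE.
rewrite {1}e (le_trans (cnrmD _ _)) // cnrmM.
have -> : cnrm ('i%C : R[i]) = 1.
  by apply: realc_inj; rewrite cnrmE normc_def /= expr0n expr1n add0r sqrtr1.
have nr (r : R) : cnrm ((r%:C)%C : R[i]) = `|r|.
  by apply: realc_inj; rewrite cnrmE normc_def /= expr0n addr0 sqrtr_sqr.
by rewrite mul1r !nr.
Qed.

End ComplexNorm.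

(** * Completeness of the complex numbers for geometrically Cauchy sequences *)

(** The telescoping series of differences converges absolutely, by comparison with a geometric
    series. *)
Lemma geometric_cauchy_real_cvg (R : realType) (v : nat -> R) (C r : R) :
  0 <= r -> r < 1 -> (forall n, `|v n.+1 - v n| <= C * r ^+ n) -> cvgn v.
Proof.
move=> r0 r1 h.
have cs : cvgn (series (fun n => v n.+1 - v n)).
  apply: normed_cvg.
  apply: (@series_le_cvg _ _ (fun n => C * r ^+ n)) => //=.
  - by move=> n; rewrite mulr_ge0 ?exprn_ge0 // -[C]mulr1 -(expr0 r)
      (le_trans _ (h 0%N)).
  - by apply: (@is_cvg_geometric_series R C r); rewrite ger0_norm.
have -> : v = (fun n => v 0%N + series (fun n => v n.+1 - v n) n).
  apply/funext => n; rewrite seriesEnat /= telescope_sumr //.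
  by rewrite addrC subrK.
by apply: is_cvgD => //; exact: is_cvg_cst.
Qed.

Section ComplexSequences.
Variable R : realType.
Implicit Types u : nat -> Cx R.

Lemma geometric_cauchy_complex_cvg u (C r : R) :
  0 <= r -> r < 1 -> (forall n, cnrm (u n.+1 - u n) <= C * r ^+ n) -> cvgn u.
Proof.
move=> r0 r1 h.
have cRe : cvgn (fun n => complex.Re (u n : R[i])).
  apply: (geometric_cauchy_real_cvg r0 r1) => n.
  by rewrite -raddfB; apply: le_trans (h n); exact: ler_Re_cnrm.
have cIm : cvgn (fun n => complex.Im (u n : R[i])).
  apply: (geometric_cauchy_real_cvg r0 r1) => n.
  by rewrite -raddfB; apply: le_trans (h n); exact: ler_Im_cnrm.
set x := limn (fun n => complex.Re (u n : R[i])) in cRe.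
set y := limn (fun n => complex.Im (u n : R[i])) in cIm.
(* The limit is taken separately in the real and imaginary parts, whose errors together bound the
   modulus of the error. *)
apply/cvg_ex; exists ((x +i* y)%C : R[i]); apply/cvg_cnrmP.
apply: (@squeeze_cvgr _ _ _ _ (fun=> 0) (fun n =>
    `|complex.Re (u n : R[i]) - x| + `|complex.Im (u n : R[i]) - y|)).
- apply: nearW => n; rewrite cnrm_ge0 /=.
  apply: le_trans (cnrm_le_ReIm _) _.
  by case: (u n).
- exact: cvg_cst.
- rewrite -[0]addr0; apply: cvgD.
    by apply/norm_cvg0P/subr_cvg0; exact: cRe.
  by apply/norm_cvg0P/subr_cvg0; exact: cIm.
Qed.

End ComplexSequences.

Definition complex_norm (R : realType) : realNorm R (Cx R) :=
  RealNorm (@cnrm_ge0 R) (@cnrm_nat R) (@cnrmN R) (@cnrmV R) (@cnrmM R)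
    (@cnrmD R) (@cvg_cnrmP R) (@geometric_cauchy_complex_cvg R).

Theorem mainTheorem1 (R : realType) (q : R[i]) (M : nat)
    (a b : 'I_M.+3 -> R[i])
    (hq0 : 0 < `|q|) (hq1 : `|q| < 1)
    (hM : (1 <= M)%N)
    (ha0 : forall i, a i != 0) (hb0 : forall i, b i != 0)
    (haa : forall (i j : 'I_M.+3) (m : int), i != j -> a i / a j != q ^ m)
    (hab : forall i, qtheta q (a ord0 / b i) != 0)
    (hbt : forall (i k : 'I_M.+3) (n : nat),
        qpoch q (b i * (q ^+ n.+1 / a k)) != 0)
    (hbal : \prod_(i < M.+3) a i = q ^+ 2 * \prod_(i < M.+3) b i) :
  \sum_(k < M.+3 | k != ord0)
    Ctilde q a b k * jackson q (integrand q a b) (q / a ord0) (q / a k) = 0.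
Proof.
have q0 : q != 0 by rewrite -normr_gt0.
have q1 : complex_norm R q < 1 by rewrite -ltcR cnrmE.
apply: (@jackson_integral_sum R (Cx R) (complex_norm R) q M a b) => // i k.
(* The exponent 1 is the case n = 0 of [hbt], the first point of the Jackson sum at q / a_k. *)
have -> : q / (a k / b i) = b i * (q ^+ 1 / a k).
  by rewrite expr1; field; rewrite (ha0 k) (hb0 i).
exact: hbt.
Qed.
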